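(* Let $X$ be a real Banach space. Then the quotient Banach space $Lip_0(X)/Lip_0^{ph}(X)$ is linearly isometrically isomorphic to the dual space $$\left(\overline{\operatorname{span}}^{\|\cdot\|}\{ r\delta_x-\delta_{rx} : r\ge 0,\ x\in X\}\right)^{*},$$ where the closed span is taken in $F(X)$.
   Context: $Lip_0(X)$ is the Banach space of all Lipschitz functions $f:X\to\mathbb{R}$ with $f(0)=0$, with norm $Lip(f)=\sup_{x\neq y}\frac{|f(x)-f(y)|}{\|x-y\|}$. $Lip_0^{ph}(X)=\{f\in Lip_0(X): f(\alpha x)=\alpha f(x)\ \forall \alpha\ge 0,\ x\in X\}$, a closed subspace. For $x\in X$, $\delta_x\in Lip_0(X)^*$ is the evaluation functional $\delta_x(f)=f(x)$. The Lipschitz-free space is $F(X)=\overline{\operatorname{span}}^{\|\cdot\|}\{\delta_x : x\in X\}\subset Lip_0(X)^*$. *)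

(* Defs.v *)
From HB Require Import structures.
From mathcomp Require Import all_boot all_order all_algebra.
From mathcomp Require Import all_classical all_reals all_analysis.

Set Implicit Arguments.
Unset Strict Implicit.
Unset Printing Implicit Defensive.

Import Order.TTheory GRing.Theory Num.Theory.
Import numFieldNormedType.Exports.

Local Open Scope classical_set_scope.
Local Open Scope ring_scope.
Local Open Scope quotient_scope.

Section dual.
Context (R : realType) (V : normedModType R).

Definition dual_pred : {pred V -> R} :=
  [pred f : V -> R | `[< linear f /\ continuous f >]].

Lemma dual_submod_closed : submod_closed dual_pred.
Proof.
split.
  apply/asboolP; split => [a u v|]; last exact: cst_continuous.
  by rewrite scaler0 addr0.
move=> a f g /asboolP[lf cf] /asboolP[lg cg]; apply/asboolP; split.
  move=> b u v; rewrite !fctE /= lf lg !scalerDr !scalerA (mulrC a b).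
  by rewrite addrACA.
move=> x; apply: cvgD; last exact: cg.
by apply: cvgZr; exact: cf.
Qed.

HB.instance Definition _ :=
  GRing.isSubmodClosed.Build R (V -> R) dual_pred dual_submod_closed.

Record dual := Dual { dual_fun :> V -> R; _ : dual_fun \in dual_pred }.

HB.instance Definition _ := [isSub for dual_fun].
HB.instance Definition _ := [Choice of dual by <:].
HB.instance Definition _ := [SubChoice_isSubLmodule of dual by <:].

Lemma dual_linear (f : dual) : linear f.
Proof. by case: f => f /= /asboolP[]. Qed.

HB.instance Definition _ (f : dual) :=
  GRing.isLinear.Build R V R *:%R f (@dual_linear f).

Lemma dual_continuous (f : dual) : continuous f.
Proof. by case: f => f /= /asboolP[]. Qed.

Definition dual_norm (f : dual) : R :=
  sup [set `|f v| | v in [set v : V | `|v| <= 1]].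

Lemma dual_has_sup (f : dual) :
  has_sup [set `|f v| | v in [set v : V | `|v| <= 1]].
Proof.
split; first by exists `|f 0|; exists 0 => //=; rewrite normr0.
have /linear_boundedP : bounded_near f (nbhs (0 : V)).
  exact/linear_bounded_continuous/dual_continuous.
move=> /pinfty_ex_gt0[M M0 fM]; exists M => _ [v v1 <-].
by rewrite (le_trans (fM v))// ler_piMr// ltW.
Qed.

Lemma dual_norm_ub (f : dual) v : `|v| <= 1 -> `|f v| <= dual_norm f.
Proof.
by move=> v1; apply: sup_upper_bound; [exact: dual_has_sup|exists v].
Qed.

Lemma dual_norm_le (f : dual) M :
  (forall v : V, `|v| <= 1 -> `|f v| <= M) -> dual_norm f <= M.
Proof.
move=> fM; apply: ge_sup; first by have [] := dual_has_sup f.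
by move=> _ [v v1 <-]; exact: fM.
Qed.

Lemma dual_ler_normD (f g : dual) :
  dual_norm (f + g) <= dual_norm f + dual_norm g.
Proof.
apply: dual_norm_le => v v1; rewrite (le_trans (ler_normD _ _))//.
by rewrite lerD// dual_norm_ub.
Qed.

Lemma dual_normrZ (a : R) (f : dual) : dual_norm (a *: f) = `|a| * dual_norm f.
Proof.
have le b (g : dual) : dual_norm (b *: g) <= `|b| * dual_norm g.
  by apply: dual_norm_le => v v1; rewrite normrZ ler_wpM2l// dual_norm_ub.
apply/eqP; rewrite eq_le le/=.
have [->|a0] := eqVneq a 0.
  rewrite normr0 mul0r scale0r.
  by apply: le_trans (dual_norm_ub _ (v := 0) _); rewrite ?normr0.
rewrite -ler_pdivlMl ?normr_gt0// -normfV.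
by rewrite -[X in dual_norm X <= _](scalerK a0) le.
Qed.

Lemma dual_normr0_eq0 (f : dual) : dual_norm f = 0 -> f = 0.
Proof.
move=> f0; apply/val_inj/funext => v /=; apply/eqP; rewrite -normr_le0.
have [->|v0] := eqVneq v 0; first by rewrite linear0 normr0.
have: `|f (`|v|^-1 *: v)| <= 0.
  by rewrite -f0 dual_norm_ub// normrZ normfV normr_id mulVf// normr_eq0.
by rewrite linearZ normrZ pmulr_rle0// normr_gt0 invr_eq0 normr_eq0.
Qed.

HB.instance Definition _ := Lmodule_isNormed.Build R dual
  dual_ler_normD dual_normrZ dual_normr0_eq0.

Lemma dual_normE (f : dual) : `|f| = dual_norm f. Proof. by []. Qed.

End dual.

Arguments dual_pred {R} V.

Section closed_span.
Context (R : realType) (V : normedModType R) (A : set V).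

Definition linear_span : set V :=
  [set v | exists n (a : 'I_n -> R) (u : 'I_n -> V),
    (forall i, A (u i)) /\ v = \sum_(i < n) a i *: u i].

Definition closed_span_pred : {pred V} := [pred v | v \in closure linear_span].

Lemma linear_span0 : linear_span 0.
Proof.
exists 0%N, (fun=> 0), (fun=> 0).
by split; [case|rewrite big_ord0].
Qed.

Lemma linear_spanP a u v :
  linear_span u -> linear_span v -> linear_span (a *: u + v).
Proof.
move=> [m [b [x [Ax ->]]]] [n [c [y [Ay ->]]]].
exists (m + n)%N,
  (fun i => match fintype.split i with inl j => a * b j | inr j => c j end),
  (fun i => match fintype.split i with inl j => x j | inr j => y j end).
split; first by move=> i; case: fintype.split.
rewrite big_split_ord /= scaler_sumr; congr (_ + _); apply: eq_bigr => i _.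
  by rewrite (unsplitK (inl i)) scalerA.
by rewrite (unsplitK (inr i)).
Qed.

Lemma closed_span_submod_closed : submod_closed closed_span_pred.
Proof.
split; first by rewrite !inE; apply: subset_closure; exact: linear_span0.
move=> a u v; rewrite !inE => cu cv.
have h : {for (u, v), continuous (fun z : V * V => a *: z.1 + z.2)}.
  apply: cvgD; last exact: cvg_snd.
  by apply: cvgZr; exact: cvg_fst.
move=> B /h [[B1 B2]/= [B1u B2v] B12].
have [x [sx B1x]] := cu _ B1u; have [y [sy B2y]] := cv _ B2v.
exists (a *: x + y); split; first exact: linear_spanP.
exact: (B12 (x, y)).
Qed.

HB.instance Definition _ :=
  GRing.isSubmodClosed.Build R V closed_span_pred closed_span_submod_closed.

Record closed_span :=
  ClosedSpan { closed_span_val :> V; _ : closed_span_val \in closed_span_pred }.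

HB.instance Definition _ := [isSub for closed_span_val].
HB.instance Definition _ := [Choice of closed_span by <:].
HB.instance Definition _ := [SubChoice_isSubLmodule of closed_span by <:].

Definition closed_span_norm (v : closed_span) : R := `|val v|.

Lemma closed_span_ler_normD (u v : closed_span) :
  closed_span_norm (u + v) <= closed_span_norm u + closed_span_norm v.
Proof. exact: ler_normD. Qed.

Lemma closed_span_normrZ (a : R) (v : closed_span) :
  closed_span_norm (a *: v) = `|a| * closed_span_norm v.
Proof. exact: normrZ. Qed.

Lemma closed_span_normr0_eq0 (v : closed_span) :
  closed_span_norm v = 0 -> v = 0.
Proof. by move=> /normr0_eq0 v0; exact: val_inj. Qed.

HB.instance Definition _ := Lmodule_isNormed.Build R closed_span
  closed_span_ler_normD closed_span_normrZ closed_span_normr0_eq0.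

Lemma closed_span_normE (v : closed_span) : `|v| = `|val v|.
Proof. by []. Qed.

Lemma mem_closed_span v : A v -> v \in closed_span_pred.
Proof.
move=> Av; rewrite !inE; apply: subset_closure.
exists 1%N, (fun=> 1), (fun=> v).
by split=> //; rewrite big_ord1 scale1r.
Qed.

Definition to_closed_span v (Av : A v) : closed_span :=
  ClosedSpan (mem_closed_span Av).

End closed_span.

Definition submod_zmodClosed (R : realType) (V : lmodType R) (W : {pred V})
    (W_submod : submod_closed W) : zmodClosed V :=
  HB.pack W (GRing.isZmodClosed.Build V W (GRing.submod_closedB W_submod)).

(* The closedness proof is a parameter of the type because the quotient
   seminorm is a norm only when [W] is closed. *)
Definition normed_quotient (R : realType) (V : normedModType R) (W : {pred V})
    (W_submod : submod_closed W) (W_closed : closed [set v : V | v \in W]) :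
    Type :=
  Quotient.quot (submod_zmodClosed W_submod).

Section normed_quotient.
Context (R : realType) (V : normedModType R) (W : {pred V}).
Context (W_submod : submod_closed W) (W_closed : closed [set v : V | v \in W]).

Let W0 := submod_zmodClosed W_submod.

Notation Q := (normed_quotient W_submod W_closed).

HB.instance Definition _ := GRing.Zmodule.copy Q (Quotient.quot W0).

Definition quot_pi (v : V) : Q := \pi_(Quotient.quot W0) v.

Lemma quot_piP u v : quot_pi u = quot_pi v <-> u - v \in W.
Proof.
rewrite -[u - v \in W]/(u - v \in W0) Quotient.idealrBE.
by split => [|/eqP//]; move=> /eqP.
Qed.

Lemma quot_piD u v : quot_pi (u + v) = quot_pi u + quot_pi v.
Proof. exact: (@pi_addr _ _ _ _ _ (Quotient.quot W0)). Qed.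

Definition quot_repr (q : Q) : V := repr (q : Quotient.quot W0).

Lemma quot_reprK : cancel quot_repr quot_pi.
Proof. by move=> q; exact: reprK. Qed.

Definition quot_scale (a : R) (q : Q) : Q := quot_pi (a *: quot_repr q).

Lemma quot_piZ a v : quot_pi (a *: v) = quot_scale a (quot_pi v).
Proof.
apply/quot_piP; rewrite -scalerBr -[_ *: _]addr0.
apply: W_submod.2; last exact: W_submod.1.
by apply/quot_piP; rewrite quot_reprK.
Qed.

Lemma quot_scalerA a b q : quot_scale a (quot_scale b q) = quot_scale (a * b) q.
Proof. by rewrite -[q]quot_reprK -!quot_piZ scalerA. Qed.

Lemma quot_scale1r : left_id 1 quot_scale.
Proof. by move=> q; rewrite -[q]quot_reprK -!quot_piZ scale1r. Qed.

Lemma quot_scalerDr : right_distributive quot_scale +%R.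
Proof.
move=> a p q; rewrite -[p]quot_reprK -[q]quot_reprK.
by rewrite -quot_piD -!quot_piZ -quot_piD scalerDr.
Qed.

Lemma quot_scalerDl q : {morph quot_scale^~ q : a b / a + b}.
Proof.
move=> a b /=; rewrite -[q]quot_reprK.
by rewrite -!quot_piZ -quot_piD scalerDl.
Qed.

HB.instance Definition _ := GRing.Zmodule_isLmodule.Build R Q
  quot_scalerA quot_scale1r quot_scalerDr quot_scalerDl.

Lemma quot_pi_linear : linear quot_pi.
Proof. by move=> a u v; rewrite quot_piD quot_piZ. Qed.

HB.instance Definition _ := GRing.isLinear.Build R V Q *:%R quot_pi
  quot_pi_linear.

Definition quot_norm (q : Q) : R := inf [set `|v| | v in quot_pi @^-1` [set q]].

Lemma quot_has_lbound (q : Q) :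
  has_lbound [set `|v| | v in quot_pi @^-1` [set q]].
Proof. by exists 0 => _ [v _ <-]. Qed.

Lemma quot_norm_lb (v : V) : quot_norm (quot_pi v) <= `|v|.
Proof. by apply: ge_inf; [exact: quot_has_lbound|exists v]. Qed.

Lemma quot_norm_ge (q : Q) M :
  (forall v, quot_pi v = q -> M <= `|v|) -> M <= quot_norm q.
Proof.
move=> qM; apply: lb_le_inf => [|_ [v vq <-]]; last exact: qM.
by exists `|quot_repr q|; exists (quot_repr q) => //=; rewrite quot_reprK.
Qed.

Lemma quot_ler_normD p q : quot_norm (p + q) <= quot_norm p + quot_norm q.
Proof.
rewrite -lerBlDr; apply: quot_norm_ge => u <-.
rewrite lerBlDl -lerBlDr; apply: quot_norm_ge => v <-.
by rewrite lerBlDr -quot_piD addrC (le_trans (quot_norm_lb _))// ler_normD.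
Qed.

Lemma quot_normrZ (a : R) (q : Q) : quot_norm (a *: q) = `|a| * quot_norm q.
Proof.
have le b p : b != 0 -> `|b| * quot_norm p <= quot_norm (b *: p).
  move=> b0; apply: quot_norm_ge => v vbp.
  rewrite -ler_pdivlMl ?normr_gt0// -normfV -normrZ.
  have -> : p = quot_pi (b^-1 *: v).
    by rewrite quot_piZ vbp -[RHS]/(b^-1 *: (b *: p)) scalerK.
  exact: quot_norm_lb.
have [->|a0] := eqVneq a 0.
  rewrite normr0 mul0r scale0r; apply/eqP; rewrite eq_le; apply/andP; split.
    rewrite -[X in quot_norm X](linear0 quot_pi).
    by rewrite (le_trans (quot_norm_lb _))// normr0.
  by apply: quot_norm_ge => v _.
apply/eqP; rewrite eq_le le// andbT.
rewrite -ler_pdivrMl ?normr_gt0// -normfV.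
by rewrite (le_trans (le _ _ _)) ?invr_eq0// scalerK.
Qed.

Lemma quot_normr0_eq0 (q : Q) : quot_norm q = 0 -> q = 0.
Proof.
move=> q0; rewrite -[q]quot_reprK.
rewrite -[RHS](linear0 quot_pi); apply/quot_piP; rewrite subr0.
apply: W_closed => B; rewrite -nbhs_ballE => -[e /= e0 eB].
have [|_ [v /= vq <-] ve] :=
    @inf_adherent _ [set `|v| | v in quot_pi @^-1` [set q]] e e0.
  split; last exact: quot_has_lbound.
  by exists `|quot_repr q|; exists (quot_repr q) => //=; rewrite quot_reprK.
exists (quot_repr q - v); split.
  by apply/quot_piP; rewrite quot_reprK.
apply: eB; rewrite -ball_normE /= opprB addrC subrK.
by move: ve; rewrite -/(quot_norm q) q0 add0r.
Qed.

HB.instance Definition _ := Lmodule_isNormed.Build R Q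
  quot_ler_normD quot_normrZ quot_normr0_eq0.

Lemma quot_normE (q : Q) : `|q| = quot_norm q. Proof. by []. Qed.

End normed_quotient.

Section Lip0.
Context (R : realType) (X : normedModType R).

Definition Lip0_pred : {pred X -> R} :=
  [pred f : X -> R | `[< lipschitz f /\ f 0 = 0 >]].

Lemma lipschitzP (f : X -> R) :
  lipschitz f <-> exists M, forall x y, `|f x - f y| <= M * `|x - y|.
Proof.
have FT : ProperFilter (globally ([set: X] `*` [set: X])).
  exact: (@globally_properfilter _ _ (0, 0)).
rewrite /lipschitz_on ex_dom_bound; split=> -[M fM]; exists M.
  by move=> x y; exact: (fM (x, y)).
by move=> [x y] _; exact: fM.
Qed.

Lemma Lip0_submod_closed : submod_closed Lip0_pred.
Proof.
split.
  apply/asboolP; split=> //; apply/lipschitzP; exists 0 => x y.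
  by rewrite subrr normr0 mul0r.
move=> a f g /asboolP[/lipschitzP[M fM] f0] /asboolP[/lipschitzP[N gN] g0].
apply/asboolP; split; last by rewrite !fctE /= f0 g0 scaler0 addr0.
apply/lipschitzP; exists (`|a| * M + N) => x y; rewrite !fctE /=.
rewrite opprD addrACA -scalerBr (le_trans (ler_normD _ _))// mulrDl lerD//.
by rewrite normrZ -mulrA ler_wpM2l.
Qed.

HB.instance Definition _ :=
  GRing.isSubmodClosed.Build R (X -> R) Lip0_pred Lip0_submod_closed.

Record Lip0 := MkLip0 { Lip0_fun :> X -> R; _ : Lip0_fun \in Lip0_pred }.

HB.instance Definition _ := [isSub for Lip0_fun].
HB.instance Definition _ := [Choice of Lip0 by <:].
HB.instance Definition _ := [SubChoice_isSubLmodule of Lip0 by <:].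

Lemma Lip0_0 (f : Lip0) : f 0 = 0.
Proof. by case: f => f /= /asboolP[]. Qed.

Lemma Lip0D (f g : Lip0) x : (f + g) x = f x + g x. Proof. by []. Qed.

Lemma Lip0Z a (f : Lip0) x : (a *: f) x = a * f x. Proof. by []. Qed.

(* When [X] is trivial the set below is empty and [sup set0 = 0]. *)
Definition Lip (f : Lip0) : R :=
  sup [set r | exists x y : X, x != y /\ r = `|f x - f y| / `|x - y|].

Lemma Lip_has_ubound (f : Lip0) :
  has_ubound [set r | exists x y : X, x != y /\ r = `|f x - f y| / `|x - y|].
Proof.
case: f => f /= /asboolP[/lipschitzP[M fM] _]; exists M => _ [x [y [xy ->]]].
by rewrite ler_pdivrMr ?normr_gt0 ?subr_eq0.
Qed.

Lemma LipP (f : Lip0) x y : `|f x - f y| <= Lip f * `|x - y|.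
Proof.
have [->|xy] := eqVneq x y; first by rewrite !subrr !normr0 mulr0.
rewrite -ler_pdivrMr ?normr_gt0 ?subr_eq0//.
by apply: ub_le_sup; [exact: Lip_has_ubound|exists x, y].
Qed.

Lemma Lip_ge0 (f : Lip0) : 0 <= Lip f.
Proof.
have [A0|/set0P[r Ar]] := eqVneq
    [set r | exists x y : X, x != y /\ r = `|f x - f y| / `|x - y|] set0.
  by rewrite /Lip A0 sup0.
apply: le_trans (ub_le_sup (Lip_has_ubound f) Ar).
by case: Ar => x [y [_ ->]]; rewrite divr_ge0.
Qed.

Lemma Lip_le (f : Lip0) M : 0 <= M ->
  (forall x y, `|f x - f y| <= M * `|x - y|) -> Lip f <= M.
Proof.
move=> M0 fM.
have [A0|/set0P A0] := eqVneq
    [set r | exists x y : X, x != y /\ r = `|f x - f y| / `|x - y|] set0.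
  by rewrite /Lip A0 sup0.
apply: ge_sup => // _ [x [y [xy ->]]].
by rewrite ler_pdivrMr ?normr_gt0 ?subr_eq0.
Qed.

Lemma Lip_ler_normD (f g : Lip0) : Lip (f + g) <= Lip f + Lip g.
Proof.
apply: Lip_le => [|x y]; first by rewrite addr_ge0// Lip_ge0.
rewrite !Lip0D opprD addrACA (le_trans (ler_normD _ _))// mulrDl.
by rewrite lerD// LipP.
Qed.

Lemma Lip_normrZ (a : R) (f : Lip0) : Lip (a *: f) = `|a| * Lip f.
Proof.
have le b (g : Lip0) : Lip (b *: g) <= `|b| * Lip g.
  apply: Lip_le => [|x y]; first by rewrite mulr_ge0// Lip_ge0.
  by rewrite !Lip0Z -mulrBr normrM -mulrA ler_wpM2l// LipP.
apply/eqP; rewrite eq_le le/=.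
have [->|a0] := eqVneq a 0; first by rewrite normr0 mul0r Lip_ge0.
rewrite -ler_pdivlMl ?normr_gt0// -normfV.
by rewrite -[X in Lip X <= _](scalerK a0) le.
Qed.

Lemma Lip_normr0_eq0 (f : Lip0) : Lip f = 0 -> f = 0.
Proof.
move=> f0; apply/val_inj/funext => x /=; apply/eqP; rewrite -normr_le0.
by have := LipP f x 0; rewrite f0 mul0r Lip0_0 subr0.
Qed.

HB.instance Definition _ := Lmodule_isNormed.Build R Lip0
  Lip_ler_normD Lip_normrZ Lip_normr0_eq0.

Lemma Lip_normE (f : Lip0) : `|f| = Lip f. Proof. by []. Qed.

Lemma delta_dual (x : X) : (fun f : Lip0 => f x) \in dual_pred Lip0.
Proof.
have lx : linear (fun f : Lip0 => f x) by [].
apply/asboolP; split=> //.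
pose F : {linear Lip0 -> R} := HB.pack (fun f : Lip0 => f x)
  (GRing.isLinear.Build R Lip0 R *:%R (fun f : Lip0 => f x) lx).
apply: (@bounded_linear_continuous _ _ _ F); apply/linear_boundedP.
near=> M => f /=; have := LipP f x 0; rewrite Lip0_0 !subr0 => /le_trans; apply.
by rewrite mulrC ler_wpM2r ?Lip_ge0.
Unshelve. all: by end_near. Qed.

Definition delta (x : X) : dual Lip0 := Dual (delta_dual x).

Definition Lip0ph_pred : {pred Lip0} :=
  [pred f : Lip0 |
    `[< forall (a : R) (x : X), 0 <= a -> f (a *: x) = a * f x >]].

Lemma Lip0ph_submod_closed : submod_closed Lip0ph_pred.
Proof.
split; first by apply/asboolP => a x _; rewrite mulr0.
move=> b f g /asboolP fh /asboolP gh; apply/asboolP => a x a0.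
by rewrite !Lip0D !Lip0Z fh// gh// mulrDr mulrCA.
Qed.

Lemma Lip0ph_closed : closed [set f : Lip0 | f \in Lip0ph_pred].
Proof.
have -> : [set f : Lip0 | f \in Lip0ph_pred] =
    \bigcap_(p in [set p : R * X | 0 <= p.1])
      (fun f : Lip0 => (delta (p.1 *: p.2) - p.1 *: delta p.2) f) @^-1` [set 0].
  apply/seteqP; split => [f /asboolP fh [a x] /= a0|f fh].
    by rewrite !fctE /= fh// subrr.
  apply/asboolP => a x a0; apply/eqP; rewrite -subr_eq0.
  by apply/eqP; exact: (fh (a, x)).
apply: closed_bigI => p _; apply: preimage_closed; last exact: closed_eq.
by move=> f _; exact: dual_continuous.
Qed.

Definition free_space : Type := closed_span (range delta).

HB.instance Definition _ := NormedModule.on free_space.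

Definition free_delta (x : X) : free_space :=
  to_closed_span (imageT delta x).

Definition defect_span : Type :=
  closed_span [set m : free_space | exists (r : R) (x : X),
    0 <= r /\ m = r *: free_delta x - free_delta (r *: x)].

HB.instance Definition _ := NormedModule.on defect_span.

Definition Lip0_quot_Lip0ph : Type :=
  normed_quotient Lip0ph_submod_closed Lip0ph_closed.

HB.instance Definition _ := NormedModule.on Lip0_quot_Lip0ph.

End Lip0.

(* Main.v *)
(** Let [D] be the closed span of the vectors [r delta_x - delta_(r x)]; a
    Lipschitz function [f] acts on it by [m |-> m f], with norm at most
    [Lip f]. It acts as zero iff it vanishes on the generators of [D], that is,
    iff [f] is positively homogeneous. Conversely, a functional on [D] extends
    by Hahn-Banach to a functional [psi] of the same norm on the free space,
    and since [|delta_x - delta_y| <= |x - y|] the function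
    [x |-> psi delta_x] is Lipschitz with constant [|psi|] and represents the
    given functional. Hence the induced map on the quotient is onto, and the
    good representative gives the reverse norm inequality. *)
Require Import Defs.
From HB Require Import structures.
From mathcomp Require Import all_boot all_order all_algebra.
From mathcomp Require Import all_classical all_reals all_analysis.

Import Order.TTheory GRing.Theory Num.Theory.
Import numFieldNormedType.Exports.

Local Open Scope ring_scope.

Set Implicit Arguments.
Unset Strict Implicit.

(** * Hahn-Banach extension under a sublinear bound *)

Section hahn_banach.
Local Open Scope classical_set_scope.
Context (R : realType) (V : lmodType R) (p : V -> R).
Hypothesis pD : forall u v, p (u + v) <= p u + p v.
Hypothesis pZ : forall a u, 0 < a -> p (a *: u) = a * p u.

(** Partial functionals are encoded by their graphs, so that chains have plain unions as upper
    bounds. Single-valuedness is not imposed: it follows from linearity and domination. *)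
Definition linear_graph (g : set (V * R^o)) :=
  forall a x y, g x -> g y -> g (a *: x + y).

Definition dominated_graph (g : set (V * R^o)) := forall x, g x -> x.2 <= p x.1.

(** The value [c] at [v] must lie above all [x.2 - p (x.1 - v)] and below all [p (y.1 + v) - y.2].
    Subadditivity puts each lower bound below each upper one, so the supremum of the former
    works. *)
Lemma dominated_graph_extend (g : set (V * R^o)) (v : V) :
  g 0 -> linear_graph g -> dominated_graph g ->
  exists c : R^o, dominated_graph
    [set z | exists x t, g x /\ z = x + t *: (v, c)].
Proof.
move=> g0 gL gp.
pose S := [set x.2 - p (x.1 - v) | x in g].
have Sub y : g y -> ubound S (p (y.1 + v) - y.2).
  move=> gy _ [x gx <-]; rewrite lerBlDr addrAC lerBrDr.
  have := gp _ (gL 1 _ _ gx gy); rewrite scale1r => /le_trans; apply.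
  rewrite (addrC (p _)) (addrC y.1).
  by have := pD (x.1 - v) (v + y.1); rewrite addrA subrK.
have Ss : has_sup S.
  by split; [eexists; exists 0; first exact: g0|eexists; exact: (Sub _ g0)].
exists (sup S) => _ [x [t [gx ->]]] /=.
have gZ a : g (a *: x) by rewrite -[_ *: _]addr0; exact: gL.
(* Scaling by the inverse of [|t|] reduces to [t = -1], a lower bound on [c], or [t = 1], an upper
   bound. *)
have [t0|t0|->] := ltgtP t 0; last 1 first.
- by rewrite !scale0r !addr0 gp.
- have nt0 : 0 < - t by rewrite oppr_gt0.
  have : S (((- t)^-1 *: x).2 - p (((- t)^-1 *: x).1 - v)).
    by exists ((- t)^-1 *: x).
  move/(sup_upper_bound Ss); rewrite lerBlDr -(ler_pM2l nt0) mulrDr -pZ//.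
  rewrite scalerBr scalerA mulrA /= mulfV ?gt_eqF// scale1r mul1r.
  by rewrite !scaleNr opprK mulNr addrC lerBrDr addrC.
- have := ge_sup Ss.1 (Sub _ (gZ t^-1)).
  rewrite lerBrDr -(ler_pM2l t0) -pZ// mulrDr scalerDr /= scalerA mulrA.
  by rewrite mulfV ?gt_eqF// scale1r mul1r addrC.
Qed.

Theorem hahn_banach (g : set (V * R^o)) :
  g 0 -> linear_graph g -> dominated_graph g ->
  exists f : V -> R,
    [/\ linear f, forall u, f u <= p u & forall x, g x -> f x.1 = x.2].
Proof.
move=> g0 gL gp.
(* With [g `<=` h] as last clause the empty chain would have no bound. *)
pose P (h : set (V * R^o)) :=
  [/\ linear_graph h, dominated_graph h & h !=set0 -> g `<=` h].
have [F FP Ftot|h [[hL hp gh] hmax]] := @Zorn_bigcup _ P.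
  split=> [a x y [A FA Ax] [B FB By]|x [A FA Ax]|[x [A FA Ax]] y gy].
  - have [AB|BA] := Ftot _ _ FA FB.
      by exists B => //; have [BL _ _] := FP _ FB; exact/BL/By/AB.
    by exists A => //; have [AL _ _] := FP _ FA; apply: AL => //; exact: BA.
  - by have [_ Ap _] := FP _ FA; exact: Ap.
  - by exists A => //; have [_ _ gA] := FP _ FA; apply: gA => //; exists x.
have {}gh : g `<=` h.
  apply: gh; apply/set0P/eqP => h0; apply: (hmax g); last by split=> // _ x.
  by rewrite h0; split=> // /(_ _ g0).
(* Otherwise the one-dimensional extension [k] would contradict maximality. *)
have htot v : exists c : R, h (v, c).
  have [c cp] := dominated_graph_extend v (gh _ g0) hL hp.
  set k := [set z | _] in cp; exists c.
  have hk : h `<=` k by move=> x hx; exists x, 0; rewrite scale0r addr0.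
  suff kh : k `<=` h.
    by apply: kh; exists 0, 1; split; [exact: gh|rewrite add0r scale1r].
  apply: contrapT => kh; apply: (hmax k); first by split=> // /(_ kh).
  split=> //; last by move=> _; exact: subset_trans hk.
  move=> a _ _ [x [s [hx ->]]] [y [t [hy ->]]].
  exists (a *: x + y), (a * s + t); split; first exact: hL.
  by rewrite scalerDr scalerA addrACA -scalerDl.
have [f hf] := choice htot.
(* Two values at [u] differ by some [d] with [h (0, d)], hence [d <= p 0]; homogeneity with factor 2
   gives [p 0 = 0]. *)
have hfE u c : h (u, c) -> f u = c.
  have p0 : p 0 <= 0.
    have := pZ 0 (ltr0Sn R 1).
    by rewrite scaler0 mulr_natl mulr2n -[LHS]addr0 => /addrI <-.
  have le x y : h (u, x) -> h (u, y) -> x <= y.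
    move=> hx hy; have /hp := hL (-1) _ _ hy hx.
    by rewrite /= !scaleN1r addNr addrC => /le_trans/(_ p0); rewrite subr_le0.
  by move=> hc; apply/eqP; rewrite eq_le !le.
exists f; split.
- by move=> a u v; apply: hfE; exact: (hL a (u, f u) (v, f v)).
- by move=> u; exact: (hp (u, f u)).
- by move=> [u c] /gh /hfE.
Qed.

End hahn_banach.

(** * Functionals on closed spans *)

Section dual_theory.
Local Open Scope classical_set_scope.
Context (R : realType).
Implicit Types V : normedModType R.

Lemma dual_le V (f : dual V) v : `|f v| <= `|f| * `|v|.
Proof.
have [->|v0] := eqVneq v 0; first by rewrite linear0 !normr0 mulr0.
have nv0 : 0 < `|v| by rewrite normr_gt0.
rewrite -ler_pdivrMr// mulrC -(normr_id v) -normfV -normrM.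
rewrite -[_ * _]/(_ *: _ : R) -linearZ dual_normE dual_norm_ub//.
by rewrite normrZ normfV normr_id mulVf// gt_eqF.
Qed.

Lemma bounded_dual_pred V (f : V -> R) (M : R) :
  linear f -> (forall v, `|f v| <= M * `|v|) -> f \in dual_pred V.
Proof.
move=> lf fM; apply/asboolP; split=> //.
pose F : {linear V -> R} := HB.pack f (GRing.isLinear.Build R V R *:%R f lf).
apply: (@bounded_linear_continuous _ _ _ F); apply/linear_boundedP.
near=> r => v; apply: le_trans (fM v) _.
by rewrite ler_wpM2r//; near: r; exact: nbhs_pinfty_ge.
Unshelve. all: by end_near. Qed.

Lemma dual_extension V (A : set V) (phi : dual (closed_span A)) :
  exists psi : dual V,
    `|psi| <= `|phi| /\ forall m : closed_span A, psi (val m) = phi m.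
Proof.
pose p (v : V) := `|phi| * `|v|.
pose g : set (V * R^o) := [set (val m, phi m) | m in [set: closed_span A]].
have pD u v : p (u + v) <= p u + p v.
  by rewrite -mulrDr ler_wpM2l// ler_normD.
have pZ a u : 0 < a -> p (a *: u) = a * p u.
  by move=> a0; rewrite /p normrZ gtr0_norm// mulrCA.
have [||_ [m _ <-]|f [lf fp fphi]] := hahn_banach pD pZ (g := g).
- by exists 0 => //; congr pair; exact: linear0.
- move=> a _ _ [m _ <-] [n _ <-]; exists (a *: m + n) => //.
  by congr pair; exact: linearP.
- rewrite /p -closed_span_normE /=.
  exact: le_trans (ler_norm _) (dual_le _ _).
have fN v : f (- v) = - f v.
  exact: (raddfN (HB.pack f (GRing.isLinear.Build R V R *:%R f lf)
    : {linear V -> R})).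
have f_le v : `|f v| <= `|phi| * `|v|.
  by rewrite ler_norml fp andbT lerNl -fN -(normrN v) fp.
exists (Dual (bounded_dual_pred lf f_le)); split.
  apply: dual_norm_le => v v1; apply: le_trans (f_le v) _.
  by rewrite ler_piMr.
by move=> m; apply: (fphi (val m, phi m)); exists m.
Qed.

Lemma dual_closed_span_eq0 V (A : set V) (phi : dual (closed_span A)) :
  (forall v (Av : A v), phi (to_closed_span Av) = 0) -> phi = 0.
Proof.
move=> phi0; apply/val_inj/funext => m /=.
apply/eqP; rewrite -normr_le0; apply/ler_addgt0Pr => e e0; rewrite add0r.
have /set_mem /= : val m \in closure (linear_span A) by case: m.
(* The [+ 1] keeps the denominator positive when [phi = 0]. *)
have d0 : 0 < e / (`|phi| + 1) by rewrite divr_gt0// ltr_wpDl.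
move=> /(_ _ (nbhsx_ballx (val m) _ d0)) [_ [[n [a [u [Au ->]]]]]].
rewrite -ball_normE /=.
pose w := \sum_(i < n) a i *: to_closed_span (Au i).
have -> : \sum_(i < n) a i *: u i = val w.
  by rewrite linear_sum; apply: eq_bigr => i _; rewrite linearZ.
have w0 : phi w = 0.
  by rewrite linear_sum big1// => i _; rewrite linearZ /= phi0 scaler0.
rewrite -[_ - _]/(val (m - w)) -closed_span_normE => mw.
rewrite -[phi m]subr0 -w0 -linearB (le_trans (dual_le _ _))//.
rewrite (le_trans (ler_wpM2l _ (ltW mw)))// mulrA ler_pdivrMr ?ltr_wpDl//.
by rewrite mulrC ler_pM2l// lerDl.
Qed.

End dual_theory.

(** * The action of Lipschitz functions on the defect span *)

Section defect_dual.
Local Open Scope classical_set_scope.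
Context (R : realType) (X : normedModType R).

Definition defect_eval (f : Lip0 X) (m : defect_span X) : R :=
  closed_span_val (closed_span_val m) f.

Lemma defect_eval_le f m : `|defect_eval f m| <= `|f| * `|m|.
Proof. by rewrite mulrC; exact: dual_le. Qed.

Lemma defect_eval_linear f : linear (defect_eval f).
Proof.
move=> a m n; rewrite /defect_eval.
(* Unfolding one closed span at a time: deciding the composite conversion at
   once does not terminate in practice. *)
have -> : closed_span_val (a *: m + n) =
  a *: closed_span_val m + closed_span_val n by [].
move: (closed_span_val m) (closed_span_val n) => u v.
by have -> : closed_span_val (a *: u + v) =
  a *: closed_span_val u + closed_span_val v by [].
Qed.

Definition defect_dual (f : Lip0 X) : dual (defect_span X) :=
  Dual (bounded_dual_pred (defect_eval_linear f) (defect_eval_le f)).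

Lemma defect_dual_linear : linear defect_dual.
Proof. by move=> a f g; apply/val_inj/funext => m /=; exact: linearP. Qed.

HB.instance Definition _ := GRing.isLinear.Build R (Lip0 X)
  (dual (defect_span X)) *:%R defect_dual defect_dual_linear.

Lemma norm_defect_dual f : `|defect_dual f| <= `|f|.
Proof.
apply: dual_norm_le => m m1; apply: le_trans (defect_eval_le f m) _.
by rewrite ler_piMr.
Qed.

(** On a generator the functional takes the value [r * f x - f (r *: x)], and by continuity the
    generators decide whether it vanishes. *)
Lemma defect_dual_eq0 f : defect_dual f = 0 <-> f \in Lip0ph_pred (X := X).
Proof.
split=> [f0|/asboolP fh].
  apply/asboolP => r x r0; apply/esym/eqP; rewrite -subr_eq0; apply/eqP.
  have Am : exists s y, 0 <= s /\
      r *: free_delta x - free_delta (r *: x) =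
      s *: free_delta y - free_delta (s *: y) by exists r, x.
  exact: (congr1 (fun phi => dual_fun phi (to_closed_span Am)) f0).
apply: dual_closed_span_eq0 => m Am; have [r [x [r0 mE]]] := Am.
rewrite /= /defect_eval /= mE.
by apply/eqP; rewrite subr_eq0; apply/eqP/esym; exact: fh.
Qed.

Lemma norm_delta_sub (x y : X) : `|delta x - delta y| <= `|x - y|.
Proof.
apply: dual_norm_le => f f1; apply: le_trans (LipP f x y) _.
by rewrite ler_piMl.
Qed.

Lemma defect_dual_onto (phi : dual (defect_span X)) :
  exists2 f, defect_dual f = phi & `|f| <= `|phi|.
Proof.
have [psi [psi_le psiE]] := dual_extension phi.
have fL x y : `|psi (free_delta x) - psi (free_delta y)| <= `|phi| * `|x - y|.
  rewrite -linearB (le_trans (dual_le _ _))// ler_pM//.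
  exact: norm_delta_sub.
have fP : (fun x => psi (free_delta x)) \in Lip0_pred (X := X).
  apply/asboolP; split; first by apply/lipschitzP; exists `|phi|.
  have -> : free_delta 0 = 0 :> free_space X.
    by do 2 apply: val_inj; apply/funext => f; exact: Lip0_0.
  exact: linear0.
exists (MkLip0 fP); last exact: Lip_le.
apply/eqP; rewrite -subr_eq0; apply/eqP/dual_closed_span_eq0.
move=> m Am; have [r [x [r0 mE]]] := Am.
apply/eqP; rewrite subr_eq0; apply/eqP; apply: etrans (psiE _).
by rewrite /= /defect_eval /= mE linearB linearZ.
Qed.

End defect_dual.

Unset Implicit Arguments.

Theorem corollary3p4 (R : realType) (X : completeNormedModType R) :
  exists T : {linear Lip0_quot_Lip0ph X -> dual (defect_span X)},
    bijective T /\ forall q : Lip0_quot_Lip0ph X, `|T q| = `|q|.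
Proof.
pose pi : {linear Lip0 X -> Lip0_quot_Lip0ph X} :=
  @quot_pi _ _ _ (@Lip0ph_submod_closed R X) (@Lip0ph_closed R X).
have reprK q : pi (quot_repr q) = q by exact: quot_reprK.
have piP f g : pi f = pi g <-> f - g \in Lip0ph_pred (X := X).
  exact: quot_piP.
(* Defined on a chosen representative; [Tpi] shows that the choice is immaterial. *)
pose T (q : Lip0_quot_Lip0ph X) :=
  defect_dual (quot_repr (W_closed := @Lip0ph_closed R X) q).
have Tpi f : T (pi f) = defect_dual f.
  by apply/eqP; rewrite -subr_eq0 -linearB; apply/eqP/defect_dual_eq0/piP.
have Tlin : linear T.
  move=> a p q; rewrite -(reprK p) -(reprK q).
  by rewrite -linearP !Tpi linearP.
have Tinj : injective T.
  move=> p q; rewrite -(reprK p) -(reprK q).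
  move: (quot_repr p) (quot_repr q) => f g.
  rewrite !Tpi => /eqP; rewrite -subr_eq0 -linearB => /eqP.
  by move/defect_dual_eq0/piP.
have lift phi : exists f, T (pi f) = phi /\ `|f| <= `|phi|.
  by have [f fphi fle] := defect_dual_onto phi; exists f; rewrite Tpi.
pose TL : {linear Lip0_quot_Lip0ph X -> dual (defect_span X)} :=
  HB.pack T (GRing.isLinear.Build R _ _ *:%R T Tlin).
exists TL; split.
  have [S SP] := choice lift.
  by exists (pi \o S) => [q|phi]; [apply: Tinj|]; rewrite /= (SP _).1.
move=> q; apply/eqP; rewrite eq_le; apply/andP; split.
  apply: quot_norm_ge => f <-.
  by rewrite /= -/(pi f) Tpi norm_defect_dual.
(* By injectivity the lift [f] of [T q] represents [q], so its norm bounds the infimum. *)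
have [f [/Tinj <- fle]] := lift (T q).
exact: le_trans (quot_norm_lb _ _ _) fle.
Qed.
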